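(* Let $f : X \to X$ be a cellular automaton on a one-dimensional subshift $X$. If either $f$ is asymptotically nilpotent, the limit set of $f$ is sparse, or the closure of the asymptotic set of $f$ is sparse, then $f$ has a glider.
   Context: Let $\Sigma$ be a finite alphabet containing the symbol $0$. A one-dimensional subshift is a topologically closed, shift-invariant subset $X \subset \Sigma^{\mathbb{Z}}$, where the shift is $\sigma^m(x)_i = x_{i+m}$. A cellular automaton on $X$ is a continuous map $f : X \to X$ commuting with the shift. $f$ is asymptotically nilpotent if $f^n(x) \to 0^{\mathbb{Z}}$ (in the product topology) for all $x \in X$. The limit set of $f$ is $\bigcap_{n \ge 0} f^n(X)$, and the asymptotic set of $f$ is $\bigcup_{x \in X} \bigcap_{n \ge 0} \overline{\{f^m(x) : m \geq n\}}$. A set of configurations is sparse if it contains only configurations with finitely many nonzero symbols. A glider for $f$ is a non-trivial finite configuration that is shifted by some power of $f$, that is, a configuration $x \in X$ with $x \neq 0^{\mathbb{Z}}$ having only finitely many nonzero symbols, such that $f^n(x) = \sigma^m(x)$ for some $n \geq 1$ and $m \in \mathbb{Z}$.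
   Formalization: The formal statement also assumes that f is not nilpotent (no n with f^n(X) contained in {0^Z}); as printed the claim fails for the constant map to 0^Z on {0,1}^Z, and a nilpotent f never has a glider, so only false cases are excluded. *)

(* Defs.v *)
From mathcomp Require Import all_boot all_order all_algebra.
From mathcomp Require Import all_classical topology.

Set Implicit Arguments.
Unset Strict Implicit.
Unset Printing Implicit Defensive.

Import GRing.Theory.
Local Open Scope classical_set_scope.
Local Open Scope ring_scope.

Definition config (S : finType) : Type :=
  {ptws int -> discrete_topology S}.

Section CellularAutomata.
Variables (S : finType) (zero : S).
Implicit Types (X : set (config S)) (f : config S -> config S) (x : config S).

Definition zero_config : config S := fun=> zero.

Definition shift (m : int) (x : config S) : config S := fun i => x (i + m).

Definition finite_config x : Prop := finite_set [set i | x i <> zero].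

Definition sparse X : Prop := forall x, X x -> finite_config x.

Definition subshift X : Prop :=
  closed X /\ forall m x, X x -> X (shift m x).

(* A map X -> X is given by a total map on configurations that preserves X;
   everything below only depends on its values on X. *)
Definition cellular_automaton X f : Prop :=
  [/\ forall x, X x -> X (f x),
      {within X, continuous f} &
      forall m x, X x -> f (shift m x) = shift m (f x)].

Definition asymptotically_nilpotent X f : Prop :=
  forall x, X x -> iter n f x @[n --> \oo] --> zero_config.

(* Inclusion rather than equality, so that the automaton on the empty subshift
   is nilpotent. *)
Definition nilpotent X f : Prop :=
  exists n : nat, iter n f @` X `<=` [set zero_config].

Definition limit_set X f : set (config S) :=
  \bigcap_(n in [set: nat]) (iter n f @` X).

Definition asymptotic_set X f : set (config S) :=
  \bigcup_(x in X) \bigcap_(n in [set: nat])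
    closure [set iter m f x | m in [set m : nat | (n <= m)%N]].

Definition glider X f x : Prop :=
  [/\ X x, finite_config x, x <> zero_config &
      exists (n : nat) (m : int), (1 <= n)%N /\ iter n f x = shift m x].

End CellularAutomata.

(* Main.v *)
Require Import Defs.
From mathcomp Require Import all_boot all_order all_algebra.
From mathcomp Require Import all_classical topology.
From mathcomp Require Import zify.
Set Implicit Arguments.
Unset Strict Implicit.
Unset Printing Implicit Defensive.
Import GRing.Theory.
Local Open Scope classical_set_scope.
Local Open Scope ring_scope.

(** A space-time diagram is a map [y : int -> int -> S], time being the first
    coordinate, whose rows [y t] lie in X and satisfy [f (y t) = y (t + 1)].
    As f is not nilpotent, compactness yields a diagram with a nonzero cell
    ([exists_live]), and Zorn's lemma then yields a minimal set W among the
    closed sets of diagrams that are invariant under translations of time and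
    of space and are not reduced to zero ([exists_minimal]).  Two tools make
    statements about single elements of W uniform.  By minimality and
    compactness, every pattern seen in W occurs within bounded distance of
    every nonzero cell of every element of W ([recurrence_at]).  By a Baire
    category argument, if every element of W vanishes on one of countably many
    regions [B n], then for a single n some pattern with nonzero centre forces
    vanishing on [B n] ([baire]).  Hence near each nonzero cell there is a
    place around which the element vanishes on a translate of a fixed [B n].

    Gliders come from a diagram with infinitely many past rows that are
    nonzero and of bounded width: two of these rows agree up to a shift, and f
    leads from the older one to the newer one ([glider_of_bounded_rows]).
    There are two ways to produce such rows.

    If every row of every element of W is finite ([sparse_rows_glider]), the
    two tools with [B n] the part of the row outside [-n, n] say that near
    every nonzero cell there is a nonzero row of width at most 2n + 1; zero is
    fixed by f, so a nonzero diagram has nonzero cells arbitrarily far in the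
    past.

    If every column of every element of W is zero from some time on
    ([vanishing_columns_glider]), the tools show first that columns are finite
    in the past too ([vanishing_columns_past]), and then, applied to vertical
    strips as wide as the reach of f, that near each nonzero cell lies a strip
    all of whose nonzero cells are near this cell.  A nonzero cell has a chain
    of nonzero ancestors, with bounded steps.  It is not confined to finitely
    many columns, and it cannot jump over a strip.  So, in the middle part of
    the columns it covers, all nonzero cells are near the chain, and there each
    row is narrow.  A limit of diagrams centred on the chain has all its rows
    narrow ([vanishing_columns_narrow_rows]).

    Asymptotic nilpotency means that columns vanish eventually.  The rows of W
    lie in the limit set, so a sparse limit set makes them finite.  Under the
    third hypothesis, either columns of W vanish eventually, or some limit of
    vertical translates is not zero; the rows of that limit lie in the
    asymptotic set, its translates are dense in W, and so all rows of W are in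
    the closure of the asymptotic set, hence finite
    ([closed_asymptotic_rows]). *)

(** * Topology of configurations in terms of finite windows *)

Definition agree_row (S : Type) (n : nat) (x z : int -> S) : Prop :=
  forall i : int, (`|i| <= n)%N -> x i = z i.

Lemma nbhs_cylinder (S : finType) (x : config S) (i : int) :
  nbhs x [set z : config S | z i = x i].
Proof.
apply: (@proj_continuous int (fun=> discrete_topology S) i x [set s | s = x i]).
exact: discrete_set1.
Qed.

Lemma cvg_config (S : finType) (z : nat -> config S) (x : config S) :
  (forall i, exists N, forall n, (N <= n)%N -> z n i = x i) ->
  z n @[n --> \oo] --> x.
Proof.
move=> zx; apply/cvg_sup => i A [_ [[B _ <-] Bx BA]].
have [N zN] := zx i; exists N => // n /= Nn; apply: BA.
by rewrite /preimage /= /proj /= zN.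
Qed.

(** Windows around the origin form a neighbourhood basis: a sequence that
    agrees with x on growing windows converges to x. *)
Lemma nbhs_agree_row (S : finType) (x : config S) (U : set (config S)) :
  nbhs x U -> exists n, forall z, agree_row n z x -> U z.
Proof.
move=> Ux; apply: contrapT => /forallNP nU.
have {nU}/choice [z zP] : forall n, exists z : config S, agree_row n z x /\ ~ U z.
  by move=> n; have /existsNP [z /not_implyP] := nU n; exists z.
have cz : z n @[n --> \oo] --> x.
  by apply: cvg_config => i; exists `|i|%N => n; exact: (zP n).1.
by have [N _ /(_ N (leqnn _))] := cz U Ux; exact: (zP N).2.
Qed.

Lemma closure_agree_row (S : finType) (A : set (config S)) x :
  (forall n, exists2 z, A z & agree_row n z x) -> closure A x.
Proof.
move=> Ax U /nbhs_agree_row [n nU]; have [z Az zx] := Ax n.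
by exists z; split => //; exact: nU.
Qed.

Lemma closed_agree_row (S : finType) (A : set (config S)) x :
  closed A -> (forall n, exists2 z, A z & agree_row n z x) -> A x.
Proof. by move=> cA /closure_agree_row; exact: cA. Qed.

Lemma automaton_local (S : finType) (X : set (config S)) f x i :
  cellular_automaton X f -> X x ->
  exists n, forall z, X z -> agree_row n z x -> f z i = f x i.
Proof.
move=> [_ fc _] Xx.
have : nbhs (x : subspace X) (f @^-1` [set z | z i = f x i]).
  exact: fc (nbhs_cylinder _ _).
rewrite /nbhs/= -nbhs_subspace_in // => /nbhs_agree_row [n nf].
by exists n => z Xz /nf; exact.
Qed.

Lemma nilpotent_column (S : finType) (zero : S) (X : set (config S)) f x i :
  asymptotically_nilpotent zero X f -> X x ->
  exists N, forall n, (N <= n)%N -> iter n f x i = zero.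
Proof.
move=> nf /nf /(_ _ (nbhs_cylinder (zero_config zero) i)) [N _ NP].
by exists N => n /NP.
Qed.

Lemma finite_row (S : finType) (zero : S) x : finite_config zero x ->
  exists n, forall i : int, (n < `|i|)%N -> x i = zero.
Proof.
move=> /finite_seqP [s sP]; exists (\max_(i <- s) `|i|%N) => i mi.
apply: contrapT => xi; have : [set` s] i by rewrite -sP.
by move=> /= /(@leq_bigmax_seq _ s xpredT absz) /(_ isT); rewrite leqNgt mi.
Qed.

(** * Compactness *)

Definition agree (S : Type) (n : nat) (y z : int -> int -> S) : Prop :=
  forall t i : int, (`|t| <= n)%N -> (`|i| <= n)%N -> y t i = z t i.

Lemma ultra_value (T : Type) (G : set_system T) (S : finType) (g : T -> S) :
  UltraFilter G -> exists s, G [set y | g y = s].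
Proof.
move=> GU; apply: contrapT => /forallNP nG.
have : \forall y \near G, forall s, g y <> s.
  apply: filter_forall => s.
  by have [/nG|] := in_ultra_setVsetC [set y | g y = s] GU.
by move=> /filter_ex [y /(_ (g y))].
Qed.

Lemma filter_box (T : Type) (G : set_system T) (P : int -> set T) n :
  Filter G -> (forall i, G (P i)) ->
  \forall y \near G, forall i : int, (`|i| <= n)%N -> P i y.
Proof.
move=> GF GP; elim: n => [|n IH].
  by apply: filterS (GP 0) => y Py i i0; have -> : i = 0 by lia.
apply: filterS (filterI IH (filterI (GP n.+1%:Z) (GP (- n.+1%:Z)))).
move=> y [/= Py [Pp Pn]] i; rewrite leq_eqVlt => /orP [/eqP in_|/Py //].
by have [->|->] : i = n.+1%:Z \/ i = - n.+1%:Z by lia.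
Qed.

(** Tychonoff's theorem for a finite alphabet.  The filter form serves the
    chains of Zorn's lemma, and [sequence_cluster] everything else. *)
Lemma filter_cluster (S : finType) (F : set_system (int -> int -> S)) :
  ProperFilter F ->
  exists z, forall A n, F A -> exists2 y, A y & agree n y z.
Proof.
move=> /ultraFilterLemma [G [GU FG]].
have /choice [z zP] : forall c : int * int,
    exists s, G [set y : int -> int -> S | y c.1 c.2 = s].
  by move=> c; exact: ultra_value.
exists (fun t i => z (t, i)) => A n /FG GA.
have : \forall y \near G, agree n y (fun t i => z (t, i)).
  have : \forall y \near G, forall t : int, (`|t| <= n)%N ->
      forall i : int, (`|i| <= n)%N -> y t i = z (t, i).
    by do 2!apply: filter_box => ?; exact: zP (_, _).
  by apply: filterS => y yz t i tn; exact: yz.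
by move=> /(filterI GA) /filter_ex [y []]; exists y.
Qed.

Lemma sequence_cluster (S : finType) (u : nat -> int -> int -> S) :
  exists z, forall n N, exists2 k, (N <= k)%N & agree n (u k) z.
Proof.
have [z zP] := @filter_cluster S (u n @[n --> \oo]) _.
exists z => n N; have : (u n @[n --> \oo]) (u @` [set k | (N <= k)%N]).
  by exists N => // k Nk; exists k.
by move=> /(zP _ n) [_ [k Nk <-]]; exists k.
Qed.

(** * Translations *)

Definition translate (S : Type) (a b : int) (y : int -> int -> S) : int -> int -> S :=
  fun t i => y (t + a) (i + b).

Section Agree.
Variable S : Type.
Implicit Types y z w : int -> int -> S.

Lemma agree_sym n y z : agree n y z -> agree n z y.
Proof. by move=> h t i tn iN; rewrite h. Qed.

Lemma agree_trans n y z w : agree n y z -> agree n z w -> agree n y w.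
Proof. by move=> h k t i tn iN; rewrite h ?k. Qed.

Lemma agree_le m n y z : (m <= n)%N -> agree n y z -> agree m y z.
Proof. by move=> mn h t i tm im; apply: h; apply: leq_trans mn. Qed.

Lemma agree_translate n a b y z :
  agree (n + `|a| + `|b|) y z -> agree n (translate a b y) (translate a b z).
Proof. by move=> h t i tn iN; apply: h; lia. Qed.

Lemma translate_translate a b c d y :
  translate a b (translate c d y) = translate (a + c) (b + d) y.
Proof. by rewrite /translate; apply/funext=> t; apply/funext=> i; rewrite !addrA. Qed.

Lemma translate0 y : translate 0 0 y = y.
Proof. by rewrite /translate; apply/funext=> t; apply/funext=> i; rewrite !addr0. Qed.

End Agree.

(** Finitely many indices that each have a bound have a common one. *)
Lemma box_bound (P : int -> nat -> Prop) (R : nat) :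
  (forall i m n, (m <= n)%N -> P i m -> P i n) ->
  (forall i, exists n, P i n) ->
  exists n, forall i : int, (`|i| <= R)%N -> P i n.
Proof.
move=> Pmono exP; elim: R => [|R [n nP]].
  have [n Pn] := exP 0; exists n => i i0; suff -> : i = 0 by [].
  by lia.
have [[p Pp] [q Pq]] := (exP R.+1%:Z, exP (- R.+1%:Z)).
exists (n + p + q)%N => i; rewrite leq_eqVlt => /orP [/eqP iR|iR].
  have [->|->] : i = R.+1%:Z \/ i = - R.+1%:Z by lia.
    by apply: Pmono Pp; lia.
  by apply: Pmono Pq; lia.
by apply: Pmono (nP i iR); lia.
Qed.

(** * Space-time diagrams and minimal systems *)

Section Gliders.
Variables (S : finType) (zero : S) (X : set (config S)) (f : config S -> config S).
Hypotheses (Xs : subshift X) (fX : cellular_automaton X f).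
Implicit Types (y z w : int -> int -> S) (W : set (int -> int -> S)).

Definition diagram y := forall t, X (y t) /\ f (y t) = y (t + 1).

Lemma X_shift m x : X x -> X (shift m x).
Proof. exact: Xs.2. Qed.

Lemma X_iter n x : X x -> X (iter n f x).
Proof. by have [fXX _ _] := fX; elim: n x => //= n IH x Xx; exact/fXX/IH. Qed.

Lemma iter_shift n m x : X x -> iter n f (shift m x) = shift m (iter n f x).
Proof.
have [_ _ fsh] := fX; move=> Xx; elim: n => //= n ->.
by rewrite fsh //; exact: X_iter.
Qed.

Lemma diagram_limit z :
  (forall n, exists2 y, agree n y z &
     forall t : int, (`|t| <= n)%N -> X (y t) /\ f (y t) = y (t + 1)) ->
  diagram z.
Proof.
move=> zlim; have Xz t : X (z t).
  apply: closed_agree_row Xs.1 _ => n; have [y yz dy] := zlim (n + `|t|)%N.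
  by exists (y t) => [|i iN]; [apply: (dy t _).1; lia|apply: yz; lia].
move=> t; split=> //; apply/funext => i.
have [n nP] := automaton_local i fX (Xz t).
have [y yz dy] := zlim (n + `|t| + `|i| + 1)%N.
have [Xy fy] : X (y t) /\ f (y t) = y (t + 1) by apply: dy; lia.
rewrite -(nP (y t)) => //; first by rewrite fy yz //; lia.
by move=> j jn; apply: yz; lia.
Qed.

Lemma diagram_iter n y t : diagram y -> iter n f (y t) = y (t + n%:Z).
Proof.
move=> dy; elim: n => [|n IH] /=; first by rewrite addr0.
by rewrite IH (dy _).2; congr (y _); lia.
Qed.

Lemma diagram_translate a b y : diagram y -> diagram (translate a b y).
Proof.
move=> dy t; have [Xy fy] := dy (t + a); have [_ _ fsh] := fX.
split; first exact: (X_shift b Xy).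
rewrite -[translate a b y t]/(shift b (y (t + a))) fsh // fy.
by rewrite /translate /shift; apply/funext => i; congr (y _ _); lia.
Qed.

Definition system W :=
  [/\ forall z, (forall n, exists2 y, W y & agree n y z) -> W z,
      forall a b y, W y -> W (translate a b y) &
      W `<=` diagram].

(** Only the origin is tested, which makes this a closed condition; a diagram
    with any nonzero cell has a live translate. *)
Definition live y := y 0 0 <> zero.

(** Minimality among systems with a live element, in the form in which it is
    used: a live element has a dense orbit. *)
Definition minimal W :=
  [/\ system W, exists2 z, W z & live z &
      forall z w, W z -> live z -> W w ->
        forall n, exists a b, agree n (translate a b z) w].

Lemma diagram_system : system diagram.
Proof.
split => // [z zlim|a b y]; last exact: diagram_translate.
by apply: diagram_limit => n; have [y dy yz] := zlim n; exists y.
Qed.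

Definition orbit_closure z : set (int -> int -> S) :=
  [set w | forall n, exists a b, agree n (translate a b z) w].

Lemma orbit_closure_system W z : system W -> W z -> system (orbit_closure z).
Proof.
move=> [Wc Wt Wd] Wz; split.
- move=> w wlim n; have [y yo yw] := wlim n; have [a [b zy]] := yo n.
  by exists a, b; exact: agree_trans yw.
- move=> a b y yo n; have [c [d zy]] := yo (n + `|a| + `|b|)%N.
  exists (a + c), (b + d); rewrite -translate_translate.
  exact: agree_translate.
- move=> w wo; apply: Wd; apply: Wc => n; have [a [b zw]] := wo n.
  by exists (translate a b z) => //; exact: Wt.
Qed.

Lemma orbit_closure_refl z : orbit_closure z z.
Proof. by move=> n; exists 0, 0; rewrite translate0. Qed.

Lemma orbit_closure_sub W z : system W -> W z -> orbit_closure z `<=` W.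
Proof.
move=> [Wc Wt _] Wz w wo; apply: Wc => n; have [a [b zw]] := wo n.
by exists (translate a b z) => //; exact: Wt.
Qed.

(** [Zorn_bigcup] provides maximal sets, so it is applied to the complements,
    in the set of all diagrams, of the systems with a live element.  The union
    of a chain is handled by compactness: the live elements of the systems in
    the chain generate a proper filter, and its cluster point is live and in
    all of them. *)
Lemma exists_minimal : (exists2 z, diagram z & live z) -> exists W, minimal W.
Proof.
move=> Dlive.
pose D := diagram; pose P (O : set (int -> int -> S)) :=
  system (D `\` O) /\ exists2 z, (D `\` O) z & live z.
have [F FP Ftot|O [[sO [z zO zl]] Omax]] := @Zorn_bigcup _ P.
  have [->|/set0P [O0 FO0]] := eqVneq F set0.
    by rewrite bigcup_set0 /P setD0; split=> //; exact: diagram_system.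
  split.
    split.
    - move=> z zlim; split.
        apply: diagram_limit => n; have [y [dy _] yz] := zlim n.
        by exists y.
      move=> [O FO Oz]; have [[Oc _ _] _] := FP _ FO.
      suff [] : (D `\` O) z by [].
      apply: Oc => n; have [y [dy nOy] yz] := zlim n.
      by exists y => //; split => // Oy; apply: nOy; exists O.
    - move=> a b y [dy nOy]; split; first exact: diagram_translate.
      move=> [O FO Oz]; have [[_ Ot _] _] := FP _ FO.
      have [|_ []//] := Ot a b y.
      by split => // Oy; apply: nOy; exists O.
    - by move=> y [].
  pose G := filter_from F (fun O => [set z | (D `\` O) z /\ live z]).
  have GF : ProperFilter G.
    apply: filter_from_proper; last first.
      by move=> O /FP [_ [z zO zl]]; exists z.
    apply: filter_from_filter; first by exists O0.
    move=> A B FA FB; have [AB|BA] := Ftot _ _ FA FB.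
      exists B => // z [[dz nBz] zl]; split; split => //; split => // /AB.
      exact: nBz.
    exists A => // z [[dz nBz] zl]; split; split => //; split => // /BA.
    exact: nBz.
  have [z zP] := filter_cluster GF.
  have zO O : F O -> (D `\` O) z /\ live z.
    move=> FO; have GO : G [set z | (D `\` O) z /\ live z] by exists O.
    have [[Oc _ _] _] := FP _ FO; split.
      by apply: Oc => n; have [y [yO _] yz] := zP _ n GO; exists y.
    by have [y [_ yl] yz] := zP _ 0%N GO; rewrite /live -yz.
  exists z; last exact: (zO O0 FO0).2.
  split; first exact: (zO O0 FO0).1.1.
  by move=> [O /zO [[_ nOz] _]].
exists (D `\` O); split => //; first by exists z.
move=> {zO zl} {}z w Wz zl Ww n.
apply: contrapT => nzw.
(* Otherwise the orbit closure of z is a strictly smaller system. *)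
pose O' := ~` orbit_closure z.
have oD : D `\` O' = orbit_closure z.
  apply/seteqP; split => [y [_ /contrapT]|y yo] //; split; last by move=> /(_ yo).
  by have [_ _] := orbit_closure_system sO Wz; exact.
apply: (Omax O'); last first.
  rewrite /P oD; split; first exact: orbit_closure_system Wz.
  by exists z => //; exact: orbit_closure_refl.
split => [|OO'].
  by move=> y Oy /(orbit_closure_sub sO Wz) [].
apply: nzw; apply: contrapT => nzw.
have /OO' : O' w by move=> /(_ n).
by case: Ww.
Qed.

(** If [iter n f x] is nonzero at the origin for some x in X, then starting
    from x at time -n gives a diagram on the times from -n on that is live; a
    cluster point over all n is a full diagram. *)
Lemma exists_live : ~ nilpotent zero X f -> exists2 z, diagram z & live z.
Proof.
move=> nn.
have /choice [x xP] : forall n, exists x, X x /\ iter n f x 0 <> zero.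
  move=> n; apply: contrapT => /forallNP nx; apply: nn; exists n.
  move=> _ [x Xx <-]; apply/funext => i; apply: contrapT => fxi.
  apply: (nx (shift i x)); split; first exact: X_shift.
  by rewrite iter_shift // /shift add0r.
pose u k : int -> int -> S := fun t => iter (absz (t + k%:Z)) f (x k).
have [z zP] := sequence_cluster u.
exists z.
  apply: diagram_limit => n; have [k nk kz] := zP n n.+1.
  exists (u k) => // t tn; split.
    exact: (X_iter _ (xP k).1).
  have -> // : u k (t + 1) = iter (absz (t + k%:Z)).+1 f (x k).
  by rewrite /u; have -> : absz (t + 1 + k%:Z) = (absz (t + k%:Z)).+1 by lia.
have [k _ kz] := zP 0%N 0%N.
by rewrite /live -kz // /u add0r; exact: (xP k).2.
Qed.

(** * Uniformity in a minimal system *)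

Section Minimal.
Variable W : set (int -> int -> S).
Hypothesis Wmin : minimal W.

Lemma W_limit z : (forall n, exists2 y, W y & agree n y z) -> W z.
Proof. by have [[h _ _] _ _] := Wmin; exact: h. Qed.
Lemma W_translate a b y : W y -> W (translate a b y).
Proof. by have [[_ h _] _ _] := Wmin; exact: h. Qed.
Lemma W_diagram y : W y -> diagram y.
Proof. by have [[_ _ h] _ _] := Wmin; exact: h. Qed.
Lemma W_live : exists2 y, W y & live y.
Proof. by case: Wmin. Qed.

Lemma W_cluster (u : nat -> int -> int -> S) :
  (forall k, W (u k)) ->
  exists2 z, W z & forall n N, exists2 k, (N <= k)%N & agree n (u k) z.
Proof.
move=> Wu; have [z zP] := sequence_cluster u; exists z => //.
by apply: W_limit => n; have [k _ kz] := zP n 0%N; exists (u k).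
Qed.

(** Otherwise a cluster point of live elements whose growing neighbourhoods
    of the origin avoid the pattern w is live and avoids it everywhere, although
    its orbit is dense. *)
Lemma recurrence w n : W w -> exists R : nat, forall y, W y -> live y ->
  exists a b : int, [/\ (`|a| <= R)%N, (`|b| <= R)%N & agree n (translate a b y) w].
Proof.
move=> Ww; apply: contrapT => /forallNP nR.
have /choice [u uP] : forall R : nat, exists y, [/\ W y, live y &
    forall a b : int, (`|a| <= R)%N -> (`|b| <= R)%N -> ~ agree n (translate a b y) w].
  move=> R; apply: contrapT => /forallNP ny; apply: (nR R) => y Wy yl.
  apply: contrapT => nab; apply: (ny y); split => // a b aR bR yw.
  by apply: nab; exists a, b.
have [z Wz zP] := W_cluster (fun k => let: And3 h _ _ := uP k in h).
have zl : live z.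
  have [k _ kz] := zP 0%N 0%N; have [_ ul _] := uP k.
  by rewrite /live -kz.
have [_ _ /(_ z w Wz zl Ww n) [a [b zw]]] := Wmin.
have [k kab kz] := zP (n + `|a| + `|b|)%N (`|a| + `|b|)%N.
have [_ _ /(_ a b)] := uP k; apply; try lia.
exact: agree_trans (agree_translate kz) zw.
Qed.

Lemma recurrence_at w n : W w -> exists R : nat, forall y t i, W y -> y t i <> zero ->
  exists a b : int, [/\ (`|a - t| <= R)%N, (`|b - i| <= R)%N & agree n (translate a b y) w].
Proof.
move=> /(recurrence n) [R RP]; exists R => y t i Wy yti.
have yl : live (translate t i y) by rewrite /live /translate !add0r.
have [a [b [aR bR yw]]] := RP _ (W_translate t i Wy) yl.
rewrite translate_translate in yw.
by exists (a + t), (b + i); rewrite !addrK.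
Qed.

(** Otherwise every pattern with nonzero centre can be refined, for each n in
    turn, to one that shows a nonzero cell in [B n]; the limit of these
    refinements is an element of W that vanishes on no [B n]. *)
Lemma baire (B : nat -> int -> int -> Prop) :
  (forall y, W y -> exists n, forall t i, B n t i -> y t i = zero) ->
  exists w m n, [/\ W w, live w &
    forall y, W y -> agree m y w -> forall t i, B n t i -> y t i = zero].
Proof.
move=> allB; apply: contrapT => nB.
(* A stage consists of an index n, an element w and the radius of the window
   of w that later stages preserve. *)
have step (c : nat * (int -> int -> S) * nat) : exists c' : nat * (int -> int -> S) * nat,
    W c.1.2 -> live c.1.2 ->
    [/\ W c'.1.2, live c'.1.2, agree c.2 c'.1.2 c.1.2, (c.2 < c'.2)%N &
     c'.1.1 = c.1.1.+1 /\ exists t i : int,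
       [/\ B c.1.1 t i, c'.1.2 t i <> zero, (`|t| <= c'.2)%N & (`|i| <= c'.2)%N]].
  case: c => [[n w] m] /=.
  have [[Ww wl]|nw] := pselect (W w /\ live w); last first.
    by exists (n, w, m) => Ww wl; exfalso; apply: nw.
  have [y [t [i [Wy yw Bti yti]]]] : exists y t i,
      [/\ W y, agree m y w, B n t i & y t i <> zero].
    apply: contrapT => ny; apply: nB; exists w, m, n; split => // y Wy yw t i Bti.
    by apply: contrapT => yti; apply: ny; exists y, t, i.
  exists (n.+1, y, (m + `|t| + `|i|).+1)%N => _ _ /=; split => //; last 2 first.
  - by lia.
  - by split => //; exists t, i; split => //; lia.
  by rewrite /live yw.
have /choice [g gP] := step.
have [w0 Ww0 w0l] := W_live.
pose c k := iter k g (0%N, w0, 0%N).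
have cWl k : W (c k).1.2 /\ live (c k).1.2.
  by elim: k => // k [/gP h /h []].
pose cP k := gP (c k) (cWl k).1 (cWl k).2.
have cn k : (c k).1.1 = k.
  by elim: k => // k IH; have [_ _ _ _ [-> _]] := cP k; rewrite IH.
have cm k : (k <= (c k).2)%N.
  by elim: k => // k IH; have [_ _ _ h _] := cP k; exact: leq_ltn_trans IH h.
have cle k d : ((c k).2 <= (c (k + d)%N).2)%N /\ agree (c k).2 (c (k + d)%N).1.2 (c k).1.2.
  elim: d => [|d [le_d ag_d]]; first by rewrite addn0.
  have [_ _ ag lt _] := cP (k + d)%N; rewrite addnS; split; first exact/ltnW/(leq_ltn_trans le_d).
  by apply: agree_trans ag_d; exact: agree_le ag.
have [z Wz zP] := W_cluster (fun k => (cWl k).1).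
have zc k : agree (c k).2 z (c k).1.2.
  have [j kj /agree_sym jz] := zP (c k).2 k; apply: agree_trans jz _.
  by have [_] := cle k (j - k)%N; rewrite subnKC.
have [n zB] := allB _ Wz.
have [_ _ _ _ [_ [t [i [Bti cti tm im]]]]] := cP n.
apply: cti; rewrite -(zc n.+1) //; apply: zB; by rewrite -[X in B X]cn.
Qed.


(** * Gliders from nonzero rows of bounded width *)

Definition zero_diagram : int -> int -> S := fun _ _ => zero.

Lemma zero_diagram_fixed : W zero_diagram ->
  X (zero_config zero) /\ f (zero_config zero) = zero_config zero.
Proof. by move=> /W_diagram /(_ 0). Qed.

(** Since f fixes the zero configuration, zero rows have only zero rows after
    them. *)
Lemma row_past_nonzero y t i k : W zero_diagram -> diagram y ->
  y t i <> zero -> exists j, y (t - k%:Z) j <> zero.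
Proof.
move=> /zero_diagram_fixed [_ f0] dy yti; apply: contrapT => /forallNP y0.
have {}y0 : y (t - k%:Z) = zero_config zero.
  by apply/funext => j; exact: contrapT (y0 j).
apply: yti; rewrite -[t](subrK k%:Z) -diagram_iter // y0.
suff -> : iter k f (zero_config zero) = zero_config zero by [].
by elim: k {y0} => //= k ->.
Qed.

(** Compactness plays the role of the pigeonhole principle: infinitely many of
    the rows, centred at b, agree with a cluster point on [-n, n], hence with
    one another everywhere. *)
Lemma glider_of_bounded_rows y n : diagram y ->
  (forall k : nat, exists a b : int, [/\ a <= - k%:Z, y a b <> zero &
     forall i : int, (n < `|i - b|)%N -> y a i = zero]) ->
  exists x, glider zero X f x.
Proof.
move=> dy rows.
have /choice [a /choice [b abP]] := rows.
have [z zP] := sequence_cluster (fun k => translate (a k) (b k) y).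
have [k _ kz] := zP n 0%N.
(* The index l is past [`|a k|], so the row [a l] is strictly older. *)
have [l kl lz] := zP n `|a k|%N.+1.
have [ak yk k0] := abP k; have [al yl l0] := abP l.
have same j : y (a l) (j + b l) = y (a k) (j + b k).
  have [jn|jn] := leqP `|j|%N n; last first.
    by rewrite k0 ?l0 //; lia.
  have := kz 0 j (leq0n _) jn; have := lz 0 j (leq0n _) jn.
  by rewrite /translate !add0r => -> ->.
exists (y (a l)); split.
- exact: (dy _).1.
- apply: (@sub_finite_set _ _ ((fun m : nat => b l - n%:Z + m%:Z) @` `I_(n + n).+1)).
    move=> i /= yi; have [iN|/l0 //] := leqP `|i - b l|%N n.
    by exists (absz (i - b l + n%:Z)); rewrite /=; lia.
  exact/finite_image/finite_II.
- by move=> y0; apply: yl; rewrite y0.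
- exists (absz (a k - a l)), (b l - b k); split; first by lia.
  rewrite diagram_iter //.
  have -> : a l + (absz (a k - a l))%:Z = a k by lia.
  apply/funext => i; rewrite /shift addrCA.
  by have := same (i - b k); rewrite subrK [X in y _ X]addrC => ->.
Qed.

(** * Diagrams with finite rows *)

(** The pattern w given by [baire] has nonzero centre and forces its row to be
    supported in [-n, n]; by recurrence it occurs near every nonzero cell, thus
    arbitrarily far in the past. *)
Lemma sparse_rows_glider :
  (forall y t, W y -> exists n, forall i : int, (n < `|i|)%N -> y t i = zero) ->
  exists x, glider zero X f x.
Proof.
move=> rows; have [y Wy yl] := W_live.
(* Rows being finite, horizontal translates converge to zero. *)
have W0 : W zero_diagram.
  have [z Wz zP] := W_cluster (fun k => W_translate 0 k%:Z Wy).
  suff <- : z = zero_diagram by [].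
  apply/funext => t; apply/funext => i; have [n nP] := rows y t Wy.
  have [k nk kz] := zP (`|t| + `|i|)%N (n + `|i|).+1.
  have <- : translate 0 k%:Z y t i = z t i by apply: kz; lia.
  by rewrite /translate addr0 nP //; lia.
have [|w [m [n [Ww wl wP]]]] :=
    baire (B := fun n t i => t = 0 /\ (n < `|i|)%N).
  move=> z /(rows _ 0) [n nP]; exists n => t i [-> ?]; exact: nP.
have [R RP] := recurrence_at m Ww.
apply: (@glider_of_bounded_rows y n); first exact: W_diagram.
move=> k; have [i yi] := row_past_nonzero (k + R)%N W0 (W_diagram Wy) yl.
have [a [b [aR bR yw]]] := RP _ _ _ Wy yi.
exists a, b; split; first by lia.
  have := yw 0 0 isT isT; rewrite /translate !add0r => ->; exact: wl.
move=> j jn; have := wP _ (W_translate a b Wy) yw 0 (j - b) (conj erefl jn).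
by rewrite /translate add0r subrK.
Qed.

(** * Diagrams with eventually vanishing columns *)

(** Continuity of f at the zero configuration is enough for this half of
    locality. *)
Lemma predecessor_radius : W zero_diagram -> exists r : nat,
  forall y t i, diagram y -> y (t + 1) i <> zero ->
  exists2 j, (`|j - i| <= r)%N & y t j <> zero.
Proof.
move=> /zero_diagram_fixed [X0 f0].
have [r rP] := automaton_local 0 fX X0.
exists r => y t i dy yti; apply: contrapT => nj; apply: yti.
have [_ <-] := dy t; have [_ _ fsh] := fX.
have -> : f (y t) i = f (shift i (y t)) 0 by rewrite fsh ?/shift ?add0r //; exact: (dy t).1.
rewrite rP ?f0 //; first exact/X_shift/(dy t).1.
move=> j jr; apply: contrapT => yj; apply: nj; exists (j + i) => //.
by rewrite addrK.
Qed.

(** Discrete intermediate value theorem.  The order of k and l does not matter: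
    a path that never comes within r of c stays on one side of c, so
    [p k <= c] and [p l <= c] are both compared with [p (k + l)]. *)
Lemma path_crossing (p : nat -> int) (r k l : nat) (c : int) :
  (forall k, (`|p k.+1 - p k| <= r)%N) ->
  (p k <= c <= p l) -> exists j, (`|p j - c| <= r)%N.
Proof.
move=> step /andP [kc cl]; apply: contrapT => /forallNP nj.
have side_k d : (p (k + d)%N <= c) = (p k <= c).
  elim: d => [|d IH]; first by rewrite addn0.
  by have := step (k + d)%N; have := nj (k + d)%N; have := nj (k + d).+1; rewrite addnS; lia.
have side_l d : (p (l + d)%N <= c) = (p l <= c).
  elim: d => [|d IH]; first by rewrite addn0.
  by have := step (l + d)%N; have := nj (l + d)%N; have := nj (l + d).+1; rewrite addnS; lia.
by have := side_k l; have := side_l k; have := nj l; have := nj k; rewrite addnC; lia.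
Qed.

(** Each nonzero cell of column 0 is near an occurrence of the pattern w, in one
    of finitely many columns.  In each column occurrences of w cannot lie
    arbitrarily far in the past: their centres are nonzero, while an occurrence
    empties the column after n steps. *)
Lemma vanishing_columns_past :
  (forall y, W y -> exists n : nat, forall t : int, n%:Z < t -> y t 0 = zero) ->
  forall y, W y -> exists n : nat, forall t : int, t < - n%:Z -> y t 0 = zero.
Proof.
move=> cols y Wy.
have [|w [m [n [Ww wl wP]]]] :=
    baire (B := fun n t i => n%:Z < t /\ i = 0).
  by move=> z /cols [n nP]; exists n => t i [nt ->]; exact: nP.
have [R RP] := recurrence_at m Ww.
have [N NP] : exists N : nat, forall b : int, (`|b| <= R)%N ->
    forall a, agree m (translate a b y) w -> - N%:Z <= a.
  apply: (@box_bound (fun b N => forall a, agree m (translate a b y) w -> - N%:Z <= a)).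
    by move=> b i j ij h a /h; lia.
  move=> b; have [[a0 ya0]|na] := pselect (exists a, agree m (translate a b y) w);
    last by exists 0%N => a ya; case: na; exists a.
  exists (`|a0| + n)%N => a ya; apply: contrapT => alt.
  have := wP _ (W_translate a b Wy) ya (a0 - a) 0 (conj _ erefl).
  rewrite /translate subrK add0r => h; apply: wl.
  by rewrite -ya0 // /translate !add0r; apply: h; lia.
exists (N + R)%N => t tN; apply: contrapT => yt.
have [a [b [aR bR yw]]] := RP _ _ _ Wy yt.
by have := NP b _ a yw; lia.
Qed.

(** The bound B comes from comparing two nonzero cells of the same row with
    points [p k], [p k'] of the chain of ancestors: each cell is within [r + R]
    columns and [n + R] rows of its point, hence k and k' differ by at most
    [2 * (n + R)], and the chain moves by at most r columns per step. *)
Lemma vanishing_columns_narrow_rows :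
  (forall y, W y -> exists n : nat, forall t : int, n%:Z < t -> y t 0 = zero) ->
  W zero_diagram ->
  exists B : nat, forall J : nat, exists y, [/\ W y, live y &
    forall t i i' : int, (`|i| <= J)%N -> (`|i'| <= J)%N ->
      y t i <> zero -> y t i' <> zero -> (`|i - i'| <= B)%N].
Proof.
move=> cols W0; have past := vanishing_columns_past cols.
have [r rP] := predecessor_radius W0.
have strip y K : W y -> exists n : nat, forall i : int, (`|i| <= K)%N ->
    forall t : int, (n < `|t|)%N -> y t i = zero.
  move=> Wy; apply: (@box_bound (fun i n => forall t : int, (n < `|t|)%N -> y t i = zero)).
    by move=> i m n mn h t tn; apply: h; lia.
  move=> i; have [n nP] := cols _ (W_translate 0 i Wy).
  have [n' nP'] := past _ (W_translate 0 i Wy).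
  rewrite /translate add0r in nP nP'.
  exists (n + n')%N => t tn; rewrite -[t]addr0.
  have [t0|t0] : 0 < t \/ t <= 0 by lia.
    by apply: nP; lia.
  by apply: nP'; lia.
have [|w [m [n [Ww wl wP]]]] :=
    baire (B := fun n t i => (`|i| <= r)%N /\ (n < `|t|)%N).
  move=> z /(strip _ r) [n nP]; exists n => t i [ir]; exact: nP.
have [R RP] := recurrence_at m Ww.
exists (2 * (r + R) + 2 * r * (n + R))%N => J.
have [y Wy yl] := W_live.
(* The chain of ancestors of the origin: its cell at time -k is in column
   [p k]. *)
have [p [p0 pstep py]] : exists p : nat -> int, [/\ p 0%N = 0,
    forall k, (`|p k.+1 - p k| <= r)%N & forall k, y (- k%:Z) (p k) <> zero].
  have /choice [g gP] : forall c : nat * int, exists j : int,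
      y (- c.1%:Z) c.2 <> zero -> (`|j - c.2| <= r)%N /\ y (- c.1.+1%:Z) j <> zero.
    move=> [k i] /=; have [yi|] := pselect (y (- k%:Z) i <> zero); last by exists 0.
    have [|j ? ?] := rP y (- k.+1%:Z) i (W_diagram Wy); last by exists j.
    by have -> : - k.+1%:Z + 1 = - k%:Z by lia.
  pose p := fix p k := if k is k'.+1 then g (k', p k') else 0.
  have py k : y (- k%:Z) (p k) <> zero.
    by elim: k => [|k /(gP (k, p k)) []].
  by exists p; split => // k; have [] := gP (k, p k) (py k).
have unbounded C : exists k, (C < `|p k|)%N.
  apply: contrapT => /forallNP pC; have [N NP] := strip y C Wy.
  by apply: (py N.+1); apply: NP; [have := pC N.+1|]; lia.
have [l pl] := unbounded (2 * (J + R + r + r))%N.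
have cross (c : int) : (0 <= c <= p l) || (p l <= c <= 0) -> exists k, (`|p k - c| <= r)%N.
  move=> /orP [cl|cl]; first by apply: (@path_crossing p r 0%N l) => //; rewrite p0.
  by apply: (@path_crossing p r l 0%N) => //; rewrite p0.
(* The centre [p k0] is chosen about halfway between the origin and [p l], so
   that the chain crosses every strip near it, whichever way it drifts. *)
have [k0 k0P] : exists k0, forall b : int, (`|b - p k0| <= J + R)%N ->
    exists k, (`|p k - b| <= r)%N.
  have [pl0|pl0] : 0 <= p l \/ p l < 0 by lia.
    have [|k0 k0P] := cross (J + R + r)%:Z; first by lia.
    by exists k0 => b bk0; apply: cross; lia.
  have [|k0 k0P] := cross (- (J + R + r)%:Z); first by lia.
  by exists k0 => b bk0; apply: cross; lia.
(* The strip found near a nonzero cell (t, i) is crossed by the chain at a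
   nonzero cell, which is therefore near (t, i). *)
have near t i : y t i <> zero -> (`|i - p k0| <= J)%N ->
    exists k : nat, (`|p k - i| <= r + R)%N /\ (`|(k%:Z + t)%R| <= n + R)%N.
  move=> yi iJ; have [a [b [aR bR yw]]] := RP _ _ _ Wy yi.
  have [|k kb] := k0P b; first by lia.
  exists k; split; first by lia.
  apply: contrapT => far; apply: (py k).
  have := wP _ (W_translate a b Wy) yw (- k%:Z - a) (p k - b).
  by rewrite /translate !subrK; apply; lia.
have lip k d : (`|p (k + d)%N - p k| <= r * d)%N.
  elim: d => [|d IH]; first by rewrite addn0 subrr muln0.
  by have := pstep (k + d)%N; rewrite addnS mulnS; lia.
have lip' k k' d : (`|k%:Z - k'%:Z| <= d)%N -> (`|p k - p k'| <= r * d)%N.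
  move=> kd; have [kk'|kk'] := leqP k k'.
    have := lip k (k' - k)%N; rewrite subnKC // => h.
    have : (r * (k' - k) <= r * d)%N by apply: leq_mul => //; lia.
    lia.
  have := lip k' (k - k')%N; rewrite subnKC ?(ltnW kk') // => h.
  have : (r * (k - k') <= r * d)%N by apply: leq_mul => //; lia.
  lia.
exists (translate (- k0%:Z) (p k0) y); split.
- exact: W_translate.
- by rewrite /live /translate !add0r.
move=> t i i' iJ i'J /near yi /near yi'.
have [|k [ki kt]] := yi; first by rewrite addrK.
have [|k' [ki' kt']] := yi'; first by rewrite addrK.
have := lip' k k' (2 * (n + R))%N; have -> : (r * (2 * (n + R)) = 2 * r * (n + R))%N by lia.
lia.
Qed.

(** Narrowness of the rows on growing windows passes to a limit of the diagrams,
    where it holds without restriction. *)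
Lemma vanishing_columns_glider :
  (forall y, W y -> exists n : nat, forall t : int, n%:Z < t -> y t 0 = zero) ->
  exists x, glider zero X f x.
Proof.
(* Columns vanishing eventually, vertical translates converge to zero. *)
move=> cols; have W0 : W zero_diagram.
  have [y Wy _] := W_live.
  have [z Wz zP] := W_cluster (fun k => W_translate k%:Z 0 Wy).
  suff <- : z = zero_diagram by [].
  apply/funext => t; apply/funext => i.
  have [n nP] := cols _ (W_translate 0 i Wy).
  have [k nk kz] := zP (`|t| + `|i|)%N (n + `|t|).+1.
  have <- : translate k%:Z 0 y t i = z t i by apply: kz; lia.
  by have := nP (t + k%:Z); rewrite /translate !addr0 add0r; apply; lia.
have [B] := vanishing_columns_narrow_rows cols W0.
move=> /choice [u uP].
have [z Wz zP] := W_cluster (fun k => let: And3 h _ _ := uP k in h).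
have zl : live z.
  by have [k _ kz] := zP 0%N 0%N; have [_ ul _] := uP k; rewrite /live -kz.
apply: (@glider_of_bounded_rows z B); first exact: W_diagram.
move=> k; have [i zi] := row_past_nonzero k W0 (W_diagram Wz) zl.
exists (0 - k%:Z), i; split => //; first by lia.
move=> j ij; apply: contrapT => zj.
have [l Nl lz] := zP (k + `|i| + `|j|)%N (`|i| + `|j|)%N.
have [_ _ /(_ (0 - k%:Z) j i)] := uP l.
by rewrite !lz; try lia; move=> /(_ _ _ zj zi); lia.
Qed.

End Minimal.

(** * The asymptotic set *)

(** A limit of the translates of y by times [s k] tending to infinity has its
    rows in the omega-limit sets of the rows of y. *)
Lemma asymptotic_row y z (s : nat -> int) t b :
  diagram y ->
  (forall n N, exists2 k : nat, N%:Z <= s k & agree n (translate (s k) 0 y) z) ->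
  asymptotic_set X f (shift b (z t)).
Proof.
move=> dy zP; exists (shift b (y t)); first exact: (X_shift b (dy t).1).
move=> N _; apply: closure_agree_row => n.
have [k Nk kz] := zP (n + `|t| + `|b|)%N N.
exists (iter (absz (s k)) f (shift b (y t))).
  by exists (absz (s k)) => //=; lia.
rewrite iter_shift; last exact: (dy t).1.
rewrite diagram_iter // => i iN; rewrite /shift.
have -> : t + (absz (s k))%:Z = t + s k by lia.
by rewrite -kz ?/translate ?addr0 //; lia.
Qed.

(** If a column of y does not vanish eventually, translating y in time along its
    nonzero cells gives a live cluster point, whose orbit is dense in W. *)
Lemma closed_asymptotic_rows W y : minimal W -> W y ->
  ~ (exists n : nat, forall t : int, n%:Z < t -> y t 0 = zero) ->
  forall w t, W w -> closure (asymptotic_set X f) (w t).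
Proof.
move=> Wmin Wy ny.
have /choice [s sP] : forall n : nat, exists t : int, n%:Z < t /\ y t 0 <> zero.
  move=> n; apply: contrapT => /forallNP nt; apply: ny; exists n => t tn.
  by apply: contrapT => yt; apply: (nt t).
have [z Wz zP] := W_cluster Wmin (fun k => W_translate Wmin (s k) 0 Wy).
have zl : live z.
  have [k _ kz] := zP 0%N 0%N; rewrite /live -kz // /translate !add0r.
  exact: (sP k).2.
move=> w t Ww; apply: closure_agree_row => n.
have [_ _ /(_ z w Wz zl Ww (n + `|t|)%N) [a [b zw]]] := Wmin.
exists (shift b (z (t + a))); last by move=> i iN; apply: zw; lia.
apply: (@asymptotic_row y z s); first exact: W_diagram Wy.
move=> m N; have [k Nk kz] := zP m N; exists k => //.
by have := (sP k).1; lia.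
Qed.

End Gliders.

Theorem proposition1p7 (S : finType) (zero : S) (X : set (config S))
    (f : config S -> config S) :
  subshift X -> cellular_automaton X f ->
  ~ nilpotent zero X f ->
  asymptotically_nilpotent zero X f
  \/ sparse zero (limit_set X f)
  \/ sparse zero (closure (asymptotic_set X f)) ->
  exists x : config S, glider zero X f x.
Proof.
move=> Xs fX /(exists_live Xs fX) /(exists_minimal Xs fX) [W Wmin] cases.
have [cols|[y Wy ny]] : (forall y, W y ->
      exists n : nat, forall t : int, n%:Z < t -> y t 0 = zero) \/
    exists2 y, W y & ~ exists n : nat, forall t : int, n%:Z < t -> y t 0 = zero.
- have [|ncols] := pselect (forall y, W y ->
      exists n : nat, forall t : int, n%:Z < t -> y t 0 = zero); first by left.
  right; apply: contrapT => ny; apply: ncols => y Wy.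
  by apply: contrapT => yc; apply: ny; exists y.
- exact: (vanishing_columns_glider Xs fX Wmin).
have Wrow w t : W w -> X (w t) by move=> /(W_diagram Wmin) /(_ t) [].
have sparse_glider (A : set (config S)) : sparse zero A ->
    (forall w t, W w -> A (w t)) -> exists x, glider zero X f x.
  move=> As WA; apply: (sparse_rows_glider Wmin) => w t Ww.
  exact/finite_row/As/WA.
case: cases => [nilp|[As|As]].
- case: ny; have [n nP] := nilpotent_column 0 nilp (Wrow _ 0 Wy).
  exists n => t nt.
  have := nP `|t|%N; rewrite (diagram_iter _ _ (W_diagram Wmin Wy)).
  have -> : 0 + `|t|%N%:Z = t by lia.
  by apply; lia.
- apply: (sparse_glider _ As) => w t Ww n _.
  exists (w (t - n%:Z)); first exact: Wrow.
  by rewrite (diagram_iter _ _ (W_diagram Wmin Ww)) subrK.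
- exact: (sparse_glider _ As) (closed_asymptotic_rows Xs fX Wmin Wy ny).
Qed.
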